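(* Consider a set of producers $\mathcal N=\{1,\dots,n\}$, quadratic production cost functions $C_i(q)=bq+c_iq^2/2$ with $b>0$ and $c_i>0$ for every $i\in\mathcal N$, and the affine demand function $D(p)=\gamma(\hat p-p)$ with $\gamma>0$ and $\hat p>0$. For $K>0$ let $d,a\in\mathbb R^n$ be defined by $$d_i=\frac{K(n-1)+\gamma}{Kc_i(n-1)+c_i\gamma+n+\gamma/K},\qquad a_i=\frac{K}{Kn+\gamma}-\frac{d_i}{Kn+\gamma},\qquad i\in\mathcal N,$$ and let $\Delta=\sum_{i\in\mathcal N}d_i$. Then, for every $K>0$, every Nash equilibrium $S^*$ of the $\mathrm{Lip}_K$-pay-as-bid auction game satisfies $$S_i^*(p)=K[p-x_i^*]_+\,,\qquad\forall p\in[0,p^*(S^* )],\ \forall i\in\mathcal N,$$ with activation price vector $$x^*=\left(n+\frac{\gamma}{K}\right)\frac{\hat p\gamma+b\Delta}{\gamma+\Delta}\,a+\frac bK\,d,$$ and market-clearing price $$p^*(S^* )=\frac{\hat p\gamma+b\Delta}{\gamma+\Delta}.$$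
   Context: Notation: $\mathbb R_+=[0,\infty)$, $[t]_+=\max\{t,0\}$; $\mathcal N$ is non-empty and finite. $\mathrm{Lip}_K$ is the set of non-decreasing functions $F:[0,\hat p]\to\mathbb R_+$ with $F(0)=0$ and $|F(x)-F(y)|\le K|x-y|$ for all $x,y\in[0,\hat p]$. The $\mathrm{Lip}_K$-pay-as-bid auction game is the strategic game with player set $\mathcal N$, where each player $i$ chooses a supply function $S_i\in\mathrm{Lip}_K$. Given $S=(S_1,\dots,S_n)$, the market-clearing price $p^*(S)$ is the unique $p^*\in[0,\hat p]$ with $D(p^* )=\sum_{i=1}^n S_i(p^* )$, and the utility of player $i$ is $$u_i(S)=p^*S_i(p^* )-\int_0^{p^*}S_i(p)\,dp-C_i(S_i(p^* )),\qquad p^*=p^*(S).$$ $S^*$ is a Nash equilibrium if for every $i$, $S_i^*$ maximizes $u_i(\cdot,S_{-i}^* )$ over $\mathrm{Lip}_K$.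
   Formalization: The formal theorem adds the hypothesis b ≤ p̂; for b > p̂ the zero supply profile is a Nash equilibrium with market-clearing price p̂, while the claimed price exceeds p̂, so the claim fails for every such b. *)

(* Defs.v *)
From HB Require Import structures.
From mathcomp Require Import all_boot all_order all_algebra.
From mathcomp Require Import all_classical all_reals all_analysis.

Set Implicit Arguments.
Unset Strict Implicit.
Unset Printing Implicit Defensive.

Import Order.TTheory GRing.Theory Num.Theory.
Import numFieldNormedType.Exports.

Local Open Scope classical_set_scope.
Local Open Scope ring_scope.

(* Functions on [0, phat] are represented by total functions [R -> R]; their
   values outside [0, phat] are unconstrained and irrelevant to the game. *)
Definition Lip (R : realType) (K phat : R) : set (R -> R) :=
  [set F | [/\ F 0 = 0,
      {in `[0, phat], forall x, 0 <= F x},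
      {in `[0, phat] &, {homo F : x y / x <= y}} &
      {in `[0, phat] &, forall x y, `|F x - F y| <= K * `|x - y|}]].

Definition clears_market (R : realType) (n : nat) (phat : R) (D : R -> R)
    (S : 'I_n -> R -> R) : set R :=
  [set p | p \in `[0, phat] /\ D p = \sum_(i < n) S i p].

(* [get] selects an element of the set; by [clears_market_unique] below there
   is exactly one for the profiles and demands under consideration. *)
Definition clearing_price (R : realType) (n : nat) (phat : R) (D : R -> R)
    (S : 'I_n -> R -> R) : R :=
  get (clears_market phat D S).

Definition utility (R : realType) (n : nat) (phat : R) (D : R -> R)
    (C : 'I_n -> R -> R) (i : 'I_n) (S : 'I_n -> R -> R) : R :=
  let p := clearing_price phat D S in
  p * S i p - (\int[@lebesgue_measure R]_(t in `[0, p]) S i t) - C i (S i p).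

(* [[eta S with i |-> T]] is the profile (T, S_{-i}). *)
Definition nash_equilibrium (R : realType) (n : nat) (K phat : R) (D : R -> R)
    (C : 'I_n -> R -> R) (S : 'I_n -> R -> R) : Prop :=
  (forall i, Lip K phat (S i)) /\
  (forall i T, Lip K phat T ->
     utility phat D C i [eta S with i |-> T] <= utility phat D C i S).

Lemma Lip_within_continuous (R : realType) (K phat : R) (F : R -> R) :
  0 < K -> Lip K phat F -> {within `[0, phat], continuous F}.
Proof.
move=> K0 [_ _ _ FK]; apply/subspace_continuousP => x x0p.
apply/cvgrPdist_le => e e0; rewrite near_withinE.
apply/nbhs_ballP; exists (e / K) => /=; first by rewrite divr_gt0.
move=> y; rewrite /ball/= => xye yp.
by rewrite (le_trans (FK _ _ x0p yp))// mulrC -ler_pdivlMr// ltW.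
Qed.

Lemma clears_market_unique (R : realType) (n : nat) (gamma phat K : R)
    (S : 'I_n -> R -> R) :
  0 < gamma -> 0 < phat -> 0 < K -> (forall i, Lip K phat (S i)) ->
  exists! p, clears_market phat (fun p => gamma * (phat - p)) S p.
Proof.
move=> g0 p0 K0 SL.
pose f p := \sum_(i < n) S i p - gamma * (phat - p).
have fc : {within `[0, phat], continuous f}.
  apply/subspace_continuousP => x x0p; apply: cvgB.
    apply: cvg_big => [|i _]; first exact: add_continuous.
    by have /subspace_continuousP := Lip_within_continuous K0 (SL i); exact.
  apply: cvgM; first exact: cvg_cst.
  by apply: cvgB; [exact: cvg_cst|exact: cvg_within].
have f0 : f 0 <= 0.
  rewrite /f big1 => [|i _]; last by case: (SL i).
  by rewrite sub0r subr0 oppr_le0 mulr_ge0// ltW.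
have mem1 : phat \in `[0, phat] by rewrite in_itv/= lexx ltW.
have fp : 0 <= f phat.
  rewrite /f subrr mulr0 subr0 sumr_ge0// => i _.
  by case: (SL i) => _ + _ _; apply.
have [|p pI fp0] := @IVT R f 0 phat 0 (ltW p0) fc.
  by rewrite ge_min f0/= le_max fp orbT.
have pC : clears_market phat (fun p => gamma * (phat - p)) S p.
  by split=> //; apply/esym/eqP; rewrite -subr_eq0; apply/eqP; exact: fp0.
exists p; split=> //.
have lt_absurd x y : clears_market phat (fun p => gamma * (phat - p)) S x ->
    clears_market phat (fun p => gamma * (phat - p)) S y -> x < y -> False.
  move=> [xI xE] [yI yE] xy.
  have : \sum_(i < n) S i x <= \sum_(i < n) S i y.
    by apply: ler_sum => i _; case: (SL i) => _ _ + _; apply => //; exact: ltW.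
  by rewrite -xE -yE ler_pM2l// lerD2l lerN2 leNgt xy.
by move=> q qC; case: (ltgtP p q) => // /lt_absurd; [case/(_ pC qC)|case/(_ qC pC)].
Qed.

(* Main.v *)
Require Import Defs.
From HB Require Import structures.
From mathcomp Require Import all_boot all_order all_algebra.
From mathcomp Require Import all_classical all_reals all_analysis.
From mathcomp Require Import ring lra.

Import Order.TTheory GRing.Theory Num.Theory.
Import numFieldNormedType.Exports.

Local Open Scope classical_set_scope.
Local Open Scope ring_scope.

Set Implicit Arguments.
Unset Strict Implicit.

(** The proof replaces the supply functions, one player at a time, by ramps
    [t |-> K * [t - x]_+], and then solves the first-order conditions of a
    finite-dimensional problem.

    Let [pe] be the clearing price at an equilibrium and put [q_i = S_i pe].
    Among the functions of [Lip_K] that take the value [q_i] at [pe], the ramp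
    with [x = pe - q_i / K] is the smallest one on [[0, pe]] ([Lip_ge_ramp]).
    Replacing [S_i] by it changes neither the clearing price nor the quantity,
    and can only decrease the integral that the player loses. At an equilibrium
    the two integrals are therefore equal, and by continuity [S_i] is the ramp
    on [[0, pe]] ([nash_supply_ramp]).

    A ramp that clears the market at another price [p], where the residual
    demand of player [i] is [q], gives that player
    [(p - b) q - (1/K + c_i) q^2 / 2] ([utility_ramp]). So [pe] maximizes this
    expression over the feasible prices ([nash_profit_max]). Put
    [M = K (n - 1) + gamma], the largest possible slope of residual demand, and
    [l_i = pe - b - (1/K + c_i) q_i].
    - Lowering the price a little shows that [q_i > 0] for all [i] as soon as
      [b < pe] ([nash_supply_gt0]).
    - Raising the price gives [q_i <= M l_i] if [q_i > 0] and [pe < phat]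
      ([nash_supply_le]): nothing is known of the other supplies above [pe]
      beyond their Lipschitz constant, but this bound is enough.
    - If all the [q_j] are positive, the other supplies have slope exactly [K]
      just below [pe], and lowering the price gives [M l_i <= q_i]
      ([nash_supply_ge]).

    Hence [q_i = (pe - b) d_i] ([nash_supply_clearing_price]). When [pe = phat]
    all the quantities vanish, so [pe <= b], hence [pe = b = phat], and the same
    formula holds. Summing over [i] and using market clearing gives [pe]. *)

(** * Ramps and integrals *)

(** The supply function with slope [K] and activation price [x]. *)
Definition ramp (R : realType) (K x t : R) : R := K * Num.max (t - x) 0.

Section ramp.
Variable R : realType.
Implicit Types K x t p phat : R.

Lemma ramp_eq0 K x t : t <= x -> ramp K x t = 0.
Proof. by move=> tx; rewrite /ramp max_r ?mulr0// subr_le0. Qed.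

Lemma ramp_affine K x t : x <= t -> ramp K x t = K * (t - x).
Proof. by move=> xt; rewrite /ramp max_l// subr_ge0. Qed.

Lemma ramp_ge0 K x t : 0 <= K -> 0 <= ramp K x t.
Proof. by move=> K0; rewrite mulr_ge0// le_max lexx orbT. Qed.

Lemma Lip_ramp K phat x : 0 <= K -> 0 <= x -> Lip K phat (ramp K x).
Proof.
move=> K0 x0; have mono : {homo ramp K x : u v / u <= v}.
  move=> u v uv; apply: ler_wpM2l => //.
  by rewrite ge_max !le_max lexx !orbT lerD2r uv.
have lip u v : u <= v -> ramp K x v - ramp K x u <= K * (v - u).
  move=> uv; have [xu|ux] := leP x u.
    by rewrite !ramp_affine//; [lra|exact: le_trans uv].
  rewrite (ramp_eq0 _ (ltW ux)) subr0; apply: ler_wpM2l => //.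
  by rewrite ge_max subr_ge0 uv andbT; lra.
split.
- exact: ramp_eq0.
- by move=> t _; exact: ramp_ge0.
- by move=> u v _ _; exact: mono.
- move=> u v _ _; have [uv|/ltW vu] := leP u v.
    by rewrite distrC ger0_norm ?subr_ge0 ?mono// distrC ger0_norm ?subr_ge0 ?lip.
  by rewrite ger0_norm ?subr_ge0 ?mono// ger0_norm ?subr_ge0 ?lip.
Qed.

Lemma continuous_ramp K x : continuous (ramp K x).
Proof.
move=> t; apply: cvgM; first exact: cvg_cst.
apply: (@continuous_max R R (fun t => t - x) (fun=> 0)); last exact: cvg_cst.
by apply: cvgB; [exact: cvg_id|exact: cvg_cst].
Qed.

Lemma within_continuous_integrable (f : R -> R) (u v : R) :
  {within `[u, v], continuous f} ->
  (@lebesgue_measure R).-integrable `[u, v] (EFin \o f).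
Proof.
by move=> fc; apply: continuous_compact_integrable => //; exact: segment_compact.
Qed.

Lemma Rintegral_ramp K x p : 0 <= x <= p ->
  \int[@lebesgue_measure R]_(t in `[0, p]) ramp K x t = K * (p - x) ^+ 2 / 2.
Proof.
move=> /andP[x0 xp].
(* The integral is split at [x], where the ramp has its kink. *)
have int0 : \int[@lebesgue_measure R]_(t in `[0, x]) ramp K x t = 0.
  rewrite (@eq_Rintegral _ _ _ _ _ (fun=> 0)); first by rewrite Rintegral_cst// mul0r.
  by move=> t; rewrite inE/= in_itv/= => /andP[_ tx]; rewrite ramp_eq0.
have rint (q : R) : (@lebesgue_measure R).-integrable `[0, q] (EFin \o ramp K x).
  by apply/within_continuous_integrable/continuous_subspaceT/continuous_ramp.
have [<-|xnp] := eqVneq x p; first by rewrite int0 subrr expr0n/= mulr0 mul0r.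
have xltp : x < p by rewrite lt_neqAle xnp.
have := @Rintegral_itvB R (ramp K x) (BLeft 0) (BRight p) x (rint p).
rewrite int0 subr0 !bnd_simp x0 xp => -> //.
rewrite Rintegral_itv_obnd_cbnd; last first.
  apply: integrableS (rint p) => //.
  by apply: subset_itvr; rewrite bnd_simp.
transitivity (\int[@lebesgue_measure R]_(t in `[x, p]) (K * (t - x))).
  apply: eq_Rintegral.
  by move=> t; rewrite inE/= in_itv/= => /andP[xt _]; rewrite ramp_affine.
pose F t : R := K * (t - x) ^+ 2 / 2.
have F' t : is_derive t 1 F (K * (t - x)).
  by apply: is_derive_eq; rewrite !scaler0 ?add0r /GRing.scale/=; lra.
have Fc : continuous F.
  by move=> t; apply: differentiable_continuous; apply/derivable1_diffP.
rewrite /Rintegral (@continuous_FTC2 _ _ F)//.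
- by rewrite /= /F subrr expr0n/= mulr0 mul0r subr0.
- apply: continuous_subspaceT => t; apply: cvgM; first exact: cvg_cst.
  by apply: cvgB; [exact: cvg_id|exact: cvg_cst].
- split; first by [].
  + exact/cvg_at_right_filter/Fc.
  + exact/cvg_at_left_filter/Fc.
- by move=> t _; rewrite derive1E derive_val.
Qed.

(** The ramp through the point [(p, F p)] is the smallest [K]-Lipschitz
    nonnegative function through it to the left of [p]. *)
Lemma Lip_ge_ramp K phat F p t : 0 < K -> Lip K phat F ->
  p \in `[0, phat] -> t \in `[0, p] -> ramp K (p - F p / K) t <= F t.
Proof.
move=> K0 [F0 Fge0 _ FK] pI; rewrite in_itv/= => /andP[t0 tp].
have tI : t \in `[0, phat].
  by move: pI; rewrite !in_itv/= t0 => /andP[_]; exact: le_trans.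
have [tx|/ltW xt] := leP t (p - F p / K); first by rewrite ramp_eq0 ?Fge0.
rewrite ramp_affine//; have := FK _ _ pI tI.
move=> /(le_trans (ler_norm _)); rewrite (@ger0_norm _ (p - t)) ?subr_ge0//.
have : K * (F p / K) = F p by rewrite mulrCA divff ?mulr1// gt_eqF.
by move: (F p / K) => y <-; lra.
Qed.

Lemma Lip_le K phat F p : Lip K phat F -> p \in `[0, phat] -> F p <= K * p.
Proof.
move=> [F0 Fge0 _ FK] pI.
have /andP[p0 pp] : 0 <= p <= phat by move: pI; rewrite in_itv.
have I0 : 0 \in `[0, phat] by rewrite in_itv/= lexx (le_trans p0).
by have := FK _ _ pI I0; rewrite F0 !subr0 !ger0_norm// Fge0.
Qed.

Lemma continuous_ge0_Rintegral_eq0 (a b : R) (f : R -> R) : a < b ->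
  {within `[a, b], continuous f} -> (forall x, x \in `[a, b] -> 0 <= f x) ->
  \int[@lebesgue_measure R]_(x in `[a, b]) f x <= 0 ->
  forall x, x \in `[a, b] -> f x = 0.
Proof.
move=> ab fc f0 intf x xab; apply/eqP; rewrite eq_le f0// andbT leNgt.
apply/negP => fx0.
have /andP[ax xb] : a <= x <= b by move: xab; rewrite in_itv.
have fint : (@lebesgue_measure R).-integrable `[a, b] (EFin \o f).
  exact: within_continuous_integrable.
(* [f] is at least [f x / 2] on a nondegenerate interval [[u, v]] around [x]. *)
have [e /= e0 fe] : exists2 e, 0 < e &
    forall y, `|x - y| < e -> y \in `[a, b] -> f x / 2 <= f y.
  move/subspace_continuousP : fc => /(_ x xab) /cvgrPdist_le /(_ (f x / 2)).
  rewrite near_withinE => /(_ (divr_gt0 fx0 (ltr0n _ 2))) /nbhs_ballP[e /= e0 fe].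
  exists e => // y xy yab; have := fe y xy yab.
  by rewrite /= /from_subspace => /(le_trans (ler_norm _)); lra.
pose u := Num.max a (x - e / 2); pose v := Num.min b (x + e / 2).
have uv : u < v.
  by rewrite gt_max !lt_min ab/=; apply/and3P; split; lra.
have uvab : `[u, v]%classic `<=` `[a, b]%classic.
  apply: subset_itvScc; by rewrite ?bnd_simp ?le_max ?ge_min ?lexx.
have : f x / 2 * (v - u) <= \int[@lebesgue_measure R]_(x in `[a, b]) f x.
  have -> : f x / 2 * (v - u) = \int[@lebesgue_measure R]_(_ in `[u, v]) (f x / 2).
    rewrite Rintegral_cst//= lebesgue_measure_itv/= lte_fin uv//.
  have fm := measurable_int _ fint.
  apply: (@le_trans _ _ (\int[@lebesgue_measure R]_(x in `[u, v]) f x)).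
    apply: le_Rintegral => //.
    - apply/within_continuous_integrable/continuous_subspaceT => ?.
      exact: cvg_cst.
    - by apply: integrableS fint.
    - move=> y /= yuv; apply: fe; last exact: uvab.
      move: yuv; rewrite in_itv/= ge_max le_min => /andP[/andP[_ ?] /andP[_ ?]].
      by rewrite ltr_norml; apply/andP; split; lra.
  apply: fine_le.
  - by apply: integrable_fin_num => //; apply: integrableS fint.
  - exact: integrable_fin_num.
  - by apply: ge0_subset_integral => // y /= yab; rewrite lee_fin f0.
move=> /le_trans /(_ intf); rewrite leNgt mulr_gt0 ?divr_gt0//; lra.
Qed.

(** First-order conditions are extracted from this fact: no derivative is
    needed, nor would one exist where residual demand has a kink. *)
Lemma le0_of_quadratic_bound (A B delta : R) : 0 < delta ->
  (forall h, 0 < h <= delta -> A * h <= B * h ^+ 2) -> A <= 0.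
Proof.
move=> delta0 AB; rewrite leNgt; apply/negP => A0.
have B0 : 0 < `|B| + 1 by rewrite ltr_wpDl.
pose h := Num.min delta (A / (2 * (`|B| + 1))).
have h0 : 0 < h by rewrite lt_min delta0 divr_gt0// mulr_gt0.
have := AB h; rewrite h0 ge_min lexx => /(_ isT).
rewrite expr2 mulrA ler_pM2r// => ABh.
have : h * (2 * (`|B| + 1)) <= A by rewrite -ler_pdivlMr ?mulr_gt0// ge_min lexx orbT.
have : B * h <= `|B| * h by rewrite ler_wpM2r ?ler_norm// ltW.
lra.
Qed.
End ramp.

Lemma sumr_const_predC1 (R : realType) (n : nat) (i : 'I_n) (x : R) :
  \sum_(j < n | j != i) x = (n%:R - 1) * x.
Proof.
rewrite sumr_const cardC1 card_ord -[x *+ _]mulr_natl; congr (_ * _).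
by rewrite -subn1 natrB//; exact: leq_ltn_trans (ltn_ord i).
Qed.

(** * The game *)

Section game.
Variables (R : realType) (n : nat) (b : R) (c : 'I_n -> R) (gamma phat K : R).
Hypotheses (b_gt0 : 0 < b) (c_gt0 : forall i, 0 < c i).
Hypotheses (gamma_gt0 : 0 < gamma) (phat_gt0 : 0 < phat) (K_gt0 : 0 < K).

Local Notation C := (fun (i : 'I_n) (q : R) => b * q + c i * q ^+ 2 / 2).
Local Notation D := (fun p : R => gamma * (phat - p)).

(** The largest slope, in absolute value, of the residual demand that a player
    faces: [gamma] from the demand and [K] from each of the [n - 1] opponents. *)
Definition max_slope : R := K * (n%:R - 1) + gamma.

Local Notation M := max_slope.

Implicit Types (S : 'I_n -> R -> R) (i j : 'I_n) (p q : R).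

Lemma clearing_priceP S : (forall i, Lip K phat (S i)) ->
  clears_market phat D S (clearing_price phat D S).
Proof.
move=> SL; apply: getPex.
by have [p [pC _]] := clears_market_unique gamma_gt0 phat_gt0 K_gt0 SL; exists p.
Qed.

Lemma clearing_priceE S p : (forall i, Lip K phat (S i)) ->
  clears_market phat D S p -> clearing_price phat D S = p.
Proof.
move=> SL pC; have [r [_ ru]] := clears_market_unique gamma_gt0 phat_gt0 K_gt0 SL.
by rewrite -(ru p pC) -(ru _ (clearing_priceP SL)).
Qed.

(** Residual demand of player [i] at price [p]: what the others leave. It does
    not depend on [S i]. *)
Definition residual S i p : R := gamma * (phat - p) - \sum_(j < n | j != i) S j p.

(** Utility of player [i] when a ramp of hers clears the market at price [p] with
    quantity [q]: the integral of that ramp is [q ^+ 2 / (2 * K)], which adds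
    [K^-1] to the cost coefficient [c i]. *)
Definition profit i p q : R := (p - b) * q - (K^-1 + c i) * q ^+ 2 / 2.

Lemma residual_decrease S i (u v : R) : (forall j, Lip K phat (S j)) ->
  u \in `[0, phat] -> v \in `[0, phat] -> u <= v ->
  gamma * (v - u) <= residual S i u - residual S i v <= M * (v - u).
Proof.
move=> SL uI vI uv.
have -> : residual S i u - residual S i v =
    gamma * (v - u) + \sum_(j < n | j != i) (S j v - S j u).
  by rewrite sumrB /residual; ring.
rewrite lerDl sumr_ge0/=; last first.
  by move=> j _; rewrite subr_ge0; case: (SL j) => _ _ + _; exact.
have -> : M * (v - u) = gamma * (v - u) + \sum_(j < n | j != i) (K * (v - u)).
  by rewrite (sumr_const_predC1 i) /max_slope; ring.
rewrite lerD2l; apply: ler_sum => j _; case: (SL j) => _ _ _ /(_ _ _ vI uI).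
by rewrite (@ger0_norm _ (v - u)) ?subr_ge0//; apply: le_trans; exact: ler_norm.
Qed.

Lemma utility_ramp S i p : (forall j, Lip K phat (S j)) -> p \in `[0, phat] ->
  0 <= residual S i p <= K * p ->
  utility phat D C i [eta S with i |-> ramp K (p - residual S i p / K)] =
  profit i p (residual S i p).
Proof.
move=> SL pI; have /andP[p0 pp] : 0 <= p <= phat by move: pI; rewrite in_itv.
set r := residual S i p => /andP[r0 rK].
have rKp : r / K <= p by rewrite ler_pdivrMr// mulrC.
have x0 : 0 <= p - r / K <= p.
  by rewrite subr_ge0 rKp/= gerBl divr_ge0// ltW.
have [x00 xp] := andP x0.
set T := ramp K (p - r / K).
have Tp : T p = r.
  by rewrite /T ramp_affine// subKr mulrCA divff ?mulr1// gt_eqF.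
have TL j : Lip K phat ([eta S with i |-> T] j).
  by rewrite /=; case: eqP => // _; apply: Lip_ramp => //; exact: ltW.
have price : clearing_price phat D [eta S with i |-> T] = p.
  apply: clearing_priceE => //; split => //.
  rewrite (bigD1 i)//= eqxx Tp (eq_bigr (S ^~ p)).
    by rewrite /r /residual subrK.
  by move=> j /negbTE /= ->.
rewrite /utility price /= eqxx Tp Rintegral_ramp// /profit subKr.
by field; rewrite gt_eqF.
Qed.

(** * Equilibrium supply functions *)

Section nash.
Variable S : 'I_n -> R -> R.
Hypothesis nashS : nash_equilibrium K phat D C S.

Let SL i : Lip K phat (S i). Proof. by case: nashS => + _; apply. Qed.

Local Notation pe := (clearing_price phat D S).

Let peI : pe \in `[0, phat]. Proof. by have [] := clearing_priceP SL. Qed.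

Let pe_bounds : 0 <= pe <= phat. Proof. by move: peI; rewrite in_itv. Qed.

Lemma residual_clearing_price i : residual S i pe = S i pe.
Proof.
have [_] := clearing_priceP SL; rewrite /residual => ->.
by rewrite (bigD1 i)//= addrK.
Qed.

Lemma supply_clearing_price_bounds i : 0 <= S i pe <= K * pe.
Proof. by rewrite (Lip_le (SL i))// andbT; case: (SL i) => _ + _ _; apply. Qed.

Lemma activation_price_bounds i : 0 <= pe - S i pe / K <= pe.
Proof.
have /andP[q0 qK] := supply_clearing_price_bounds i.
by rewrite subr_ge0 ler_pdivrMr// mulrC qK/= gerBl divr_ge0// ltW.
Qed.

Lemma profit_le_utility i p : p \in `[0, phat] ->
  0 <= residual S i p <= K * p ->
  profit i p (residual S i p) <= utility phat D C i S.
Proof.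
move=> pI rI; rewrite -utility_ramp//.
have /andP[r0 rK] := rI.
case: nashS => _; apply; apply: Lip_ramp; first exact: ltW.
by rewrite subr_ge0 ler_pdivrMr// mulrC.
Qed.

(** Any other function through the same clearing point would cost player [i] a
    larger integral than the ramp does. *)
Lemma nash_supply_ramp i t : t \in `[0, pe] ->
  S i t = ramp K (pe - S i pe / K) t.
Proof.
move=> tI; have /andP[pe0 pep] := pe_bounds.
have ge_ramp s : s \in `[0, pe] -> ramp K (pe - S i pe / K) s <= S i s.
  exact: Lip_ge_ramp (SL i) peI.
have x0 := activation_price_bounds i.
(* On a degenerate interval integrals say nothing, but both sides vanish at 0. *)
have [pe_eq0|pe_neq0] := eqVneq pe 0.
  have -> : t = 0 by move: tI; rewrite in_itv/= pe_eq0; lra.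
  by case: (SL i) => -> _ _ _; rewrite ramp_eq0//; case/andP: x0.
have pe_gt0 : 0 < pe by rewrite lt_neqAle eq_sym pe_neq0.
have Sc : {within `[0, pe], continuous (S i)}.
  apply: continuous_subspaceW (Lip_within_continuous K_gt0 (SL i)).
  by apply: subset_itvl; rewrite bnd_simp.
have rc : {within `[0, pe], continuous (ramp K (pe - S i pe / K))}.
  exact/continuous_subspaceT/continuous_ramp.
apply/eqP; rewrite -subr_eq0; apply/eqP.
apply: (@continuous_ge0_Rintegral_eq0 _ 0 pe
  (fun s => S i s - ramp K (pe - S i pe / K) s)) => //.
- apply/subspace_continuousP => s sI; apply: cvgB.
    by move/subspace_continuousP : Sc; exact.
  by move/subspace_continuousP : rc; exact.
- by move=> s sI; rewrite subr_ge0 ge_ramp.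
rewrite RintegralB//; try exact: within_continuous_integrable.
rewrite Rintegral_ramp// subKr subr_le0.
(* Deviating to the ramp that clears the market at the same price [pe]. *)
have := @profit_le_utility i pe peI.
rewrite residual_clearing_price supply_clearing_price_bounds => /(_ isT).
rewrite /utility /profit.
have -> : K * (S i pe / K) ^+ 2 / 2 = K^-1 * S i pe ^+ 2 / 2.
  by field; rewrite gt_eqF.
lra.
Qed.

(** Deviations to ramps: [pe] is an optimal clearing price for player [i] along
    her residual demand, among the prices at which that demand can be served by
    a function of [Lip_K]. *)
Lemma nash_profit_max i p : p \in `[0, phat] -> 0 <= residual S i p <= K * p ->
  profit i p (residual S i p) <= profit i pe (S i pe).
Proof.
move=> pI rI; apply: le_trans (profit_le_utility pI rI) _.
have x0 := activation_price_bounds i.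
rewrite /utility.
have -> : \int[@lebesgue_measure R]_(t in `[0, pe]) S i t =
    \int[@lebesgue_measure R]_(t in `[0, pe]) ramp K (pe - S i pe / K) t.
  by apply: eq_Rintegral => t; rewrite inE => tI; exact: nash_supply_ramp.
rewrite Rintegral_ramp// subKr /profit le_eqVlt; apply/orP; left; apply/eqP.
by field; rewrite gt_eqF.
Qed.

(** * First-order conditions *)

Let M_gt0 i : 0 < M.
Proof.
rewrite /max_slope ltr_wpDl// mulr_ge0 ?(ltW K_gt0)// subr_ge0 ler1n.
exact: leq_ltn_trans (ltn_ord i).
Qed.

Let kappa_gt0 i : 0 < K^-1 + c i. Proof. by rewrite addr_gt0// invr_gt0. Qed.

(** A player with no supply would gain by lowering the price to [pe - h]: she
    would sell a quantity of order [h] at a margin close to [pe - b]. *)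
Lemma nash_supply_gt0 i : b < pe -> 0 < S i pe.
Proof.
move=> bpe; have /andP[pe0 pep] := pe_bounds.
have /andP[q0 qK] := supply_clearing_price_bounds i.
rewrite lt_neqAle q0 andbT eq_sym; apply/negP => /eqP qE.
have M0 := M_gt0 i; have k0 := kappa_gt0 i.
have MK0 : 0 < M + K by rewrite addr_gt0.
suff : pe - b <= 0 by lra.
(* Up to this step size, the residual demand at [pe - h], which is at most
   [M * h], does not exceed the largest feasible quantity [K * (pe - h)]. *)
apply: (@le0_of_quadratic_bound _ _ (1 + (K^-1 + c i) * M / 2) (K * pe / (M + K))).
  by rewrite divr_gt0// mulr_gt0// (lt_trans b_gt0).
move=> h /andP[h0]; rewrite ler_pdivlMr// => hK.
have Mh0 : 0 < M * h by rewrite mulr_gt0.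
have hpe : h <= pe by rewrite -(ler_pM2l K_gt0); lra.
have pI : pe - h \in `[0, phat] by rewrite in_itv/=; apply/andP; split; lra.
have ple : pe - h <= pe by lra.
have := residual_decrease i SL pI peI ple; rewrite residual_clearing_price qE subr0.
have -> : pe - (pe - h) = h by lra.
move=> /andP[r1 r2]; have r0 : 0 < residual S i (pe - h).
  by apply: lt_le_trans r1; rewrite mulr_gt0.
have := nash_profit_max (i := i) pI; rewrite (ltW r0) /=.
rewrite /profit qE; move: r0 r2; set r := residual S i (pe - h) => r0 r2.
have -> : r <= K * (pe - h) by lra.
move=> /(_ isT).
rewrite expr0n/= !mulr0 mul0r subr0 expr2 (_ : _ - _ =
  r * (pe - h - b - (K^-1 + c i) * r / 2)); last by ring.
rewrite pmulr_rle0// => rle.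
have : (K^-1 + c i) * r <= (K^-1 + c i) * (M * h) by rewrite ler_pM2l.
move=> le2; have le3 : pe - b <= (1 + (K^-1 + c i) * M / 2) * h by lra.
by rewrite expr2 mulrA ler_pM2r.
Qed.

(** Raising the price to [pe + h] costs player [i] a quantity [r] of at most
    [M * h], and must not be profitable. *)
Lemma nash_supply_le i : pe < phat -> 0 < S i pe ->
  S i pe <= M * (pe - b - (K^-1 + c i) * S i pe).
Proof.
move=> pep q_gt0; have /andP[pe0 _] := pe_bounds.
have /andP[q0 qK] := supply_clearing_price_bounds i.
have M0 := M_gt0 i; have k0 := kappa_gt0 i.
set l := pe - b - _; set q := S i pe in q0 qK q_gt0 l *.
(* The loss [r] is only known to lie between [gamma * h] and [M * h], so the
   bound [r * l <= M * h * l] needs [0 <= l]; this sign is a consequence of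
   the same inequality for the positive part of [l]. *)
suff le_max : q <= M * Num.max l 0.
  have [l0|l0] := leP l 0.
    by move: le_max; rewrite max_r// mulr0; lra.
  by move: le_max; rewrite max_l// ltW.
rewrite -subr_le0.
apply: (@le0_of_quadratic_bound _ _ (M + (K^-1 + c i) * M ^+ 2 / 2)
  (Num.min (phat - pe) (q / M))).
  by rewrite lt_min subr_gt0 pep divr_gt0.
move=> h /andP[h0]; rewrite le_min ler_pdivlMr// => /andP[hp hq].
have pI : pe + h \in `[0, phat] by rewrite in_itv/=; apply/andP; split; lra.
have ple : pe <= pe + h by lra.
have := residual_decrease i SL peI pI ple; rewrite residual_clearing_price -/q.
have -> : pe + h - pe = h by lra.
have := nash_profit_max (i := i) pI; set r' := residual S i (pe + h).
have [r ->] : exists r, r' = q - r by exists (q - r'); lra.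
rewrite subKr => profit_le /andP[r1 r2].
have gh0 : 0 < gamma * h by rewrite mulr_gt0.
have Kh0 : 0 < K * h by rewrite mulr_gt0.
have := profit_le; have -> : 0 <= q - r <= K * (pe + h) by apply/andP; split; lra.
move=> /(_ isT); rewrite -/q /profit => {}profit_le.
have dev_le : h * q - h * r - r * l - (K^-1 + c i) * r ^+ 2 / 2 <= 0.
  by rewrite /l; move: profit_le; rewrite !expr2; lra.
have rl : r * l <= M * h * Num.max l 0.
  apply: (@le_trans _ _ (r * Num.max l 0)).
    by apply: ler_wpM2l; [lra|rewrite le_max lexx].
  by apply: ler_wpM2r => //; rewrite le_max lexx orbT.
have hr : h * r <= h * (M * h) by rewrite ler_pM2l.
have rr : (K^-1 + c i) * r ^+ 2 <= (K^-1 + c i) * (M * h) ^+ 2.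
  by rewrite ler_pM2l// lerXn2r// nnegrE; lra.
move: dev_le rl hr rr; rewrite !expr2; lra.
Qed.

(** Lowering the price to [pe - h] gains player [i] exactly the quantity
    [M * h] when all the players are active and [h] is small, and must not be
    profitable. *)
Lemma nash_supply_ge i : (forall j, 0 < S j pe) -> S i pe < K * pe ->
  M * (pe - b - (K^-1 + c i) * S i pe) <= S i pe.
Proof.
move=> active qK; have /andP[pe0 pep] := pe_bounds.
have M0 := M_gt0 i; have k0 := kappa_gt0 i.
have MK0 : 0 < M + K by rewrite addr_gt0.
set l := pe - b - _; set q := S i pe in qK l *.
have q_gt0 : 0 < q by exact: active.
rewrite -subr_le0.
(* For [h] below [S j pe / K] the ramp of player [j] is still active at [pe - h];
   below the other bound the new quantity [q + M * h] is feasible. *)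
pose delta := \big[Num.min/(K * pe - q) / (M + K)]_(j < n) (S j pe / K).
apply: (@le0_of_quadratic_bound _ _ (M + (K^-1 + c i) * M ^+ 2 / 2) delta).
  apply: lt_bigmin => [|j _]; first by rewrite divr_gt0// subr_gt0.
  by rewrite divr_gt0.
move=> h /andP[h0 hdelta].
have : h <= (K * pe - q) / (M + K).
  by apply: le_trans hdelta _; exact: bigmin_le_id.
rewrite ler_pdivlMr// => hK.
have Mh0 : 0 < M * h by rewrite mulr_gt0.
have hpe : h <= pe by rewrite -(ler_pM2l K_gt0); lra.
have pI : pe - h \in `[0, phat] by rewrite in_itv/=; apply/andP; split; lra.
have rE : residual S i (pe - h) = q + M * h.
  rewrite /residual (eq_bigr (fun j => S j pe - K * h)).
    rewrite sumrB (sumr_const_predC1 i).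
    by rewrite /q -(residual_clearing_price i) /residual /max_slope; ring.
  move=> j _; rewrite nash_supply_ramp; last by rewrite in_itv/=; apply/andP; split; lra.
  have hj : h <= S j pe / K by apply: le_trans hdelta _; exact: bigmin_le.
  by rewrite ramp_affine; [field; rewrite gt_eqF|lra].
have := nash_profit_max (i := i) pI; rewrite rE -/q /profit.
have -> : 0 <= q + M * h <= K * (pe - h) by apply/andP; split; lra.
by move=> /(_ isT); rewrite /l !expr2; lra.
Qed.

(** The factor of [pe - b] is [d_i]. *)
Lemma nash_supply_clearing_price i : b <= phat ->
  S i pe = (pe - b) * (M / (1 + M * (K^-1 + c i))).
Proof.
move=> b_phat; have /andP[pe0 pep] := pe_bounds.
have q0 j : 0 <= S j pe by case/andP: (supply_clearing_price_bounds j).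
have M0 := M_gt0 i; have k0 := kappa_gt0 i.
have [_] := clearing_priceP SL => market.
(* If [pe = phat] nothing is sold, which an equilibrium allows only if
   [pe <= b]. *)
have [pe_lt|pe_ge] := ltP pe phat; last first.
  have peE : pe = phat by apply/eqP; rewrite eq_le pep.
  have qE : S i pe = 0.
    have /eqP : \sum_(j < n) S j pe = 0 by rewrite -market peE subrr mulr0.
    by rewrite psumr_eq0// => /allP/(_ i); rewrite mem_index_enum => /(_ isT)/eqP.
  have [/(nash_supply_gt0 i)|pe_b] := ltP b pe; first by rewrite qE ltxx.
  by rewrite qE (_ : pe - b = 0) ?mul0r//; lra.
(* Otherwise somebody sells, which she only does at a price above [b]; then
   everybody sells, and both first-order conditions hold. *)
have [k qk] : exists k, 0 < S k pe.
  apply/existsP; rewrite -[X in is_true X]negbK negb_exists; apply/negP => /forallP qle.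
  have : gamma * (phat - pe) <= 0.
    by rewrite market sumr_le0// => j _; rewrite leNgt.
  by rewrite leNgt mulr_gt0// subr_gt0.
have b_pe : b < pe.
  have := nash_supply_le pe_lt qk; move=> /(lt_le_trans qk).
  rewrite pmulr_rgt0 => [|//]; have := mulr_gt0 (kappa_gt0 k) qk; lra.
have active j : 0 < S j pe by exact: nash_supply_gt0.
have le1 := nash_supply_le pe_lt (active i).
(* The capacity constraint is slack: [q / K < pe - b < pe]. *)
have qK : S i pe < K * pe.
  have := lt_le_trans (active i) le1; rewrite pmulr_rgt0// => l0.
  rewrite -ltr_pdivrMl//; have : 0 < c i * S i pe by rewrite mulr_gt0.
  have := b_gt0; lra.
have le2 := nash_supply_ge active qK.
have den0 : 0 < 1 + M * (K^-1 + c i) by rewrite ltr_wpDr// mulr_ge0// ltW.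
apply: (mulIf (lt0r_neq0 den0)); rewrite mulrA mulfVK ?lt0r_neq0//.
lra.
Qed.

End nash.
End game.

Theorem theorem3 (R : realType) (n : nat) (n_gt0 : (0 < n)%N)
    (b : R) (c : 'I_n -> R) (gamma phat : R)
    (b_gt0 : 0 < b) (c_gt0 : forall i, 0 < c i)
    (gamma_gt0 : 0 < gamma) (phat_gt0 : 0 < phat) (b_le_phat : b <= phat)
    (K : R) (K_gt0 : 0 < K) :
  let C := fun (i : 'I_n) (q : R) => b * q + c i * q ^+ 2 / 2 in
  let D := fun p : R => gamma * (phat - p) in
  let d : 'rV[R]_n := \row_i
    ((K * (n%:R - 1) + gamma) /
     (K * c i * (n%:R - 1) + c i * gamma + n%:R + gamma / K)) in
  let a : 'rV[R]_n := \row_i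
    (K / (K * n%:R + gamma) - d 0 i / (K * n%:R + gamma)) in
  let Delta : R := \sum_(i < n) d 0 i in
  forall S : 'I_n -> R -> R, nash_equilibrium K phat D C S ->
  let pstar : R := (phat * gamma + b * Delta) / (gamma + Delta) in
  let xstar : 'rV[R]_n :=
    ((n%:R + gamma / K) * pstar) *: a + (b / K) *: d in
  (forall (i : 'I_n) (p : R), 0 <= p <= clearing_price phat D S ->
     S i p = K * Num.max (p - xstar 0 i) 0) /\
  clearing_price phat D S = pstar.
Proof.
move=> C D d a Delta S nashS pstar xstar.
pose M : R := K * (n%:R - 1) + gamma.
have n1 : 1 <= n%:R :> R by rewrite ler1n.
have M0 : 0 < M by rewrite ltr_wpDl// mulr_ge0 ?(ltW K_gt0)// subr_ge0.
have dE i : d 0 i = M / (1 + M * (K^-1 + c i)).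
  rewrite mxE /M; congr (_ / _); field; exact: lt0r_neq0.
have d0 i : 0 < d 0 i.
  rewrite dE divr_gt0// ltr_wpDr// mulr_ge0// ?(ltW M0)//.
  by rewrite addr_ge0// ?invr_ge0 ltW.
have SL i : Lip K phat (S i) by case: nashS.
set pe := clearing_price phat D S.
have qE i : S i pe = (pe - b) * d 0 i.
  by rewrite dE; exact: (nash_supply_clearing_price b_gt0).
have Delta0 : 0 <= Delta by apply: sumr_ge0 => i _; exact: ltW.
have peE : pe = pstar.
  have [_] := clearing_priceP gamma_gt0 phat_gt0 K_gt0 SL.
  rewrite -/pe (eq_bigr _ (fun i _ => qE i)) -mulr_sumr -/Delta => market.
  have gD : gamma + Delta != 0 by rewrite lt0r_neq0// ltr_wpDr.
  by apply: (mulIf gD); rewrite /pstar mulfVK//; move: market; lra.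
split=> // i p pI.
rewrite (nash_supply_ramp gamma_gt0 phat_gt0 K_gt0 nashS)//.
rewrite -/pe /ramp; congr (_ * Num.max (_ - _) _).
(* The activation price [pe - S i pe / K] is the given entry of [xstar]. *)
rewrite qE /xstar !mxE -peE.
have Kn : K * n%:R + gamma != 0 by rewrite lt0r_neq0// ltr_wpDl// mulr_ge0// ltW.
have := dE i; rewrite mxE => ->.
by move: (M / _) => e; field; rewrite Kn lt0r_neq0.
Qed.
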